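(* Consider $6$-colourings of the $2\times2$-block with vertices $v_1,v_2,v_3,v_4$ and boundary vertices $z_1,\dots,z_8$, where $z_1$ is adjacent to $v_1$. Then $p^{\mathrm{low}}_{v_1}\ge 0.379$, $p^{\mathrm{low}}_{v_2}\ge 0.107$, $p^{\mathrm{low}}_{v_3}\ge 0.050$ and $p^{\mathrm{low}}_{v_4}\ge 0.107$.
   Context: The block is a $2\times2$ sub-grid of the square lattice; its vertices are labelled cyclically, so the adjacencies inside the block are $v_1v_2$, $v_2v_3$, $v_3v_4$, $v_4v_1$ (thus $v_3$ is diagonally opposite $v_1$). The boundary consists of the eight lattice vertices $z_1,\dots,z_8$ outside the block that are adjacent to some block vertex; each block vertex is adjacent to exactly two boundary vertices, each boundary vertex is adjacent to exactly one block vertex, and $z_1$ is adjacent to $v_1$ (how $z_2,\dots,z_8$ are labelled is immaterial). A boundary colouring is any function $Z:\{z_1,\dots,z_8\}\to\{1,\dots,6\}$. A proper $6$-colouring of the block agrees with $Z$ if adjacent block vertices have different colours and each block vertex has a colour different from the colours under $Z$ of its adjacent boundary vertices. Let $\pi_Z$ be the uniform distribution on the proper $6$-colourings of the block that agree with $Z$. For boundary colourings $Z,Z'$ and a coupling $\Psi$ of $\pi_Z$ and $\pi_{Z'}$, let $p_{v}(\Psi)$ be the probability that the colour of block vertex $v$ differs in the pair of colourings drawn from $\Psi$. Define $$p^{\mathrm{low}}_{v}=\max_{Z,Z'}\ \min_{\Psi}\ p_{v}(\Psi),$$ where the maximum is over all pairs $Z,Z'$ of boundary colourings that agree on every boundary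 vertex except $z_1$, on which they differ, and the minimum is over all couplings $\Psi$ of $\pi_Z$ and $\pi_{Z'}$. *)

(* Defs.v *)
From mathcomp Require Import all_boot all_order all_algebra.
From mathcomp Require Import zify.
From mathcomp Require Import all_classical all_reals.

Set Implicit Arguments.
Unset Strict Implicit.
Unset Printing Implicit Defensive.

Import Order.TTheory GRing.Theory Num.Theory.
Local Open Scope ring_scope.

Definition point := (int * int)%type.

Definition lattice_adj (p q : point) : bool :=
  (`|p.1 - q.1| + `|p.2 - q.2| == 1 :> int).

(* The block in cyclic order, followed by its outer neighbours, in cyclic order
   starting from one of the two neighbours of the first block vertex. *)
Definition block_points : seq point :=
  [:: (0, 0); (1, 0); (1, 1); (0, 1)].

Definition boundary_points : seq point :=
  [:: (0, -1); (1, -1); (2, 0); (2, 1); (1, 2); (0, 2); (-1, 1); (-1, 0)].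

Definition block_pt (i : 'I_4) : point := nth (0, 0) block_points i.
Definition boundary_pt (j : 'I_8) : point := nth (0, 0) boundary_points j.

(* The ordinals are 0-based, the labels 1-based. *)
Definition v1 : 'I_4 := @Ordinal 4 0 isT.
Definition v2 : 'I_4 := @Ordinal 4 1 isT.
Definition v3 : 'I_4 := @Ordinal 4 2 isT.
Definition v4 : 'I_4 := @Ordinal 4 3 isT.
Definition z1 : 'I_8 := @Ordinal 8 0 isT.

Definition block_adj (i k : 'I_4) : bool :=
  lattice_adj (block_pt i) (block_pt k).
Definition boundary_adj (i : 'I_4) (j : 'I_8) : bool :=
  lattice_adj (block_pt i) (boundary_pt j).

Lemma block_adjE (i k : 'I_4) :
  block_adj i k = ((k == i.+1 %% 4 :> nat) || (i == k.+1 %% 4 :> nat))%N.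
Proof. by case: i k => [[|[|[|[|i]]]] // ?] [[|[|[|[|k]]]] // ?]. Qed.

Lemma boundary_pointsP (p : point) :
  reflect (p \notin block_points /\ exists i, lattice_adj (block_pt i) p)
          (p \in boundary_points).
Proof.
apply: (iffP idP) => [|[]].
  move=> pz.
  suff: has (fun i : 'I_4 => lattice_adj (block_pt i) p) [:: v1; v2; v3; v4]
        && (p \notin block_points).
    by case/andP=> /hasP[i _ ip] pb; split=> //; exists i.
  by move: pz; rewrite !in_cons in_nil orbF; do ![case/orP=> [/eqP-> //|]]; move/eqP->.
case: p => x y; rewrite !inE !xpair_eqE => xyb [i].
by case: i xyb => [[|[|[|[|i]]]] // ?]; rewrite /lattice_adj /=; lia.
Qed.

Lemma card_boundary_nbrs (i : 'I_4) : #|[set j | boundary_adj i j]| = 2%N.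
Proof.
rewrite -sum1dep_card big_mkcond !big_ord_recl big_ord0.
by case: i => [[|[|[|[|i]]]] // ?].
Qed.

Lemma card_block_nbrs (j : 'I_8) : #|[set i | boundary_adj i j]| = 1%N.
Proof.
rewrite -sum1dep_card big_mkcond !big_ord_recl big_ord0.
by case: j => [[|[|[|[|[|[|[|[|j]]]]]]]] // ?].
Qed.

Lemma boundary_adj_z1 : boundary_adj v1 z1.
Proof. by []. Qed.

Definition boundary_colouring := {ffun 'I_8 -> 'I_6}.
Definition block_colouring := {ffun 'I_4 -> 'I_6}.

Definition agrees (Z : boundary_colouring) : {set block_colouring} :=
  [set c : block_colouring |
    [forall i, forall k, block_adj i k ==> (c i != c k)] &&
    [forall i, forall j, boundary_adj i j ==> (c i != Z j)]].

(* [agrees Z] is never empty: a block vertex has four neighbours in all, and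
   there are six colours. *)
Definition pi_ (R : realType) (Z : boundary_colouring) :
    {ffun block_colouring -> R} :=
  [ffun c => (c \in agrees Z)%:R / #|agrees Z|%:R].

Definition couplings (R : realType) (T : finType) (mu nu : {ffun T -> R}) :
    set {ffun T * T -> R} :=
  [set Psi | [/\ forall w, 0 <= Psi w,
                 forall c, \sum_d Psi (c, d) = mu c
               & forall d, \sum_c Psi (c, d) = nu d]]%classic.

Definition disagreement (R : realType) (v : 'I_4)
    (Psi : {ffun block_colouring * block_colouring -> R}) : R :=
  \sum_(w : block_colouring * block_colouring | w.1 v != w.2 v) Psi w.

(* The couplings form a nonempty compact set (it contains the product), on
   which the disagreement is continuous, so this infimum is a minimum. *)
Definition min_disagreement (R : realType) (v : 'I_4)
    (Z Z' : boundary_colouring) : R :=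
  inf [set disagreement v Psi | Psi in couplings (pi_ R Z) (pi_ R Z')]%classic.

Definition differ_only_at_z1 (Z Z' : boundary_colouring) : bool :=
  [forall j, (Z j != Z' j) == (j == z1)].

(* Every value is nonnegative and there is at least one admissible pair, so
   the default value 0 does not affect the maximum. *)
Definition p_low (R : realType) (v : 'I_4) : R :=
  \big[Num.max/0]_(ZZ : boundary_colouring * boundary_colouring
                   | differ_only_at_z1 ZZ.1 ZZ.2)
    min_disagreement R v ZZ.1 ZZ.2.

(* Main.v *)
Require Import Defs.
From mathcomp Require Import all_boot all_order all_algebra.
From mathcomp Require Import lra.
From mathcomp Require Import all_classical all_reals.
Import Order.TTheory GRing.Theory Num.Theory.
Local Open Scope ring_scope.

(** The probability that the colours of [v] differ is, under any coupling, at
    least the difference of the two probabilities that the colour of [v] lies in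
    a given set [S].  So each bound follows from one pair of boundary colourings
    and one set [S], and from counting the colourings among the 6^4 candidates. *)

Lemma coupling_event_diff {R : realType} {T : finType} {mu nu : {ffun T -> R}}
    {Psi : {ffun T * T -> R}} (A : pred T) :
  couplings mu nu Psi ->
  \sum_(c | A c) mu c - \sum_(d | A d) nu d
    <= \sum_(w | A w.1 && ~~ A w.2) Psi w.
Proof.
move=> [Psi0 Psi1 Psi2].
have -> : \sum_(c | A c) mu c = \sum_(w | A w.1) Psi w.
  under eq_bigr do rewrite -Psi1.
  by rewrite pair_big_dep /=; apply: eq_big => [[c d]|[c d] _] //=; rewrite andbT.
have -> : \sum_(d | A d) nu d = \sum_(w | A w.2) Psi w.
  under eq_bigr do rewrite -Psi2.
  rewrite (exchange_big_dep xpredT) //= pair_big_dep /=.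
  by apply: eq_big => [[c d]|[c d] _] /=; rewrite ?andbT.
(* The mass of pairs with both coordinates in [A] cancels; what is left of the subtracted sum is
   nonnegative. *)
rewrite (bigID (fun w => A w.2)) /= lerBlDr addrC lerD2l.
by rewrite [leRHS](bigID (fun w => A w.1)) /= (eq_bigl _ _ (fun w => andbC _ _))
  lerDl sumr_ge0.
Qed.

(** Shows that the set of couplings is nonempty, so that a lower bound on all its members bounds the
    infimum. *)
Lemma product_coupling (R : realType) (T : finType) (mu nu : {ffun T -> R}) :
  (forall c, 0 <= mu c) -> (forall d, 0 <= nu d) ->
  \sum_c mu c = 1 -> \sum_d nu d = 1 ->
  couplings mu nu [ffun w => mu w.1 * nu w.2].
Proof.
move=> mu0 nu0 mu1 nu1; split=> [w|c|d]; first by rewrite ffunE mulr_ge0.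
  by under eq_bigr do rewrite ffunE /=; rewrite -mulr_sumr nu1 mulr1.
by under eq_bigr do rewrite ffunE /=; rewrite -mulr_suml mu1 mul1r.
Qed.

Lemma sum_pi (R : realType) (Z : boundary_colouring) (A : pred block_colouring) :
  \sum_(c | A c) pi_ R Z c
    = #|[set c in agrees Z | A c]|%:R / #|agrees Z|%:R.
Proof.
under eq_bigr do rewrite ffunE.
rewrite -mulr_suml; congr (_ / _).
rewrite -natr_sum -sum1dep_card big_mkcondr /=; congr _%:R.
rewrite [RHS]big_mkcond [LHS]big_mkcond /=.
by apply: eq_bigr => c _; do 2 case: ifP.
Qed.

Lemma pi_ge0 (R : realType) (Z : boundary_colouring) (c : block_colouring) :
  0 <= pi_ R Z c.
Proof. by rewrite ffunE divr_ge0. Qed.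

Lemma sum_pi1 (R : realType) (Z : boundary_colouring) :
  (0 < #|agrees Z|)%N -> \sum_c pi_ R Z c = 1.
Proof.
move=> Z0; rewrite (sum_pi R Z xpredT) setIdE finset.setIT.
by rewrite divff // pnatr_eq0 -lt0n.
Qed.

Lemma le_p_low (R : realType) (v : 'I_4) (Z Z' : boundary_colouring)
    (S : pred 'I_6) :
  differ_only_at_z1 Z Z' -> (0 < #|agrees Z|)%N -> (0 < #|agrees Z'|)%N ->
  #|[set c in agrees Z | S (c v)]|%:R / #|agrees Z|%:R
    - #|[set c in agrees Z' | S (c v)]|%:R / #|agrees Z'|%:R <= p_low R v.
Proof.
move=> ZZ' Z0 Z'0.
rewrite /p_low; apply: (@bigmax_sup_seq _ _ _ _ _ (Z, Z')) => //=;
  first exact: mem_index_enum.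
apply: lb_le_inf.
  eexists; exists [ffun w => pi_ R Z w.1 * pi_ R Z' w.2]; last by [].
  by apply: product_coupling; rewrite ?sum_pi1 // => c; apply: pi_ge0.
move=> _ [Psi PsiP <-].
rewrite -!(sum_pi R _ (fun c => S (c v))).
apply: le_trans (coupling_event_diff (fun c : block_colouring => S (c v)) PsiP) _.
(* On [E] the two colours of [v] differ, so [E] is a part of the disagreement event. *)
pose E (w : block_colouring * block_colouring) := S (w.1 v) && ~~ S (w.2 v).
rewrite /disagreement [leRHS](bigID E) /=.
have [Psi0 _ _] := PsiP.
rewrite [X in X + _](eq_bigl E); last first.
  by move=> w; rewrite /E; case: eqVneq => [->|//]; rewrite andbN.
by rewrite lerDl sumr_ge0.
Qed.

(** Colourings are encoded as sequences of naturals so that counting them reduces under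
    [vm_compute]. *)
Definition words (k n : nat) : seq (seq nat) :=
  iter n (fun ws => [seq a :: w | a <- iota 0 k, w <- ws]) [:: [::]].

Lemma mem_words (k n : nat) (w : seq nat) :
  (w \in words k n) = (size w == n) && all (gtn k) w.
Proof.
elim: n w => [|n IHn] [|a w] //=.
  by apply/negbTE/negP => /allpairsP[? []].
apply/allpairsP/idP => [[[b u] /= []]|].
  by rewrite IHn mem_iota => bk /andP[su ku] [-> ->]; rewrite eqSS su ku andbT.
rewrite eqSS => /and3P[sw ak kw].
by exists (a, w); rewrite /= IHn mem_iota sw kw ak.
Qed.

Lemma words_uniq (k n : nat) : uniq (words k n).
Proof.
elim: n => //= n IHn; apply: allpairs_uniq; rewrite ?iota_uniq //.
by move=> [a u] [b w] _ _ /= [-> ->].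
Qed.

Definition word_of {k n : nat} (c : {ffun 'I_n -> 'I_k}) : seq nat :=
  [seq val (c i) | i <- enum 'I_n].

Lemma nth_word_of (k n : nat) (c : {ffun 'I_n -> 'I_k}) (i : 'I_n) :
  nth 0%N (word_of c) i = c i.
Proof. by rewrite (nth_map i) ?size_enum_ord // nth_ord_enum. Qed.

(** [word_of] is injective, and a word of length [n] with letters below [k] is the word of a
    function, so [word_of] is a bijection onto [words k n]. *)
Lemma card_ffun_words (k n : nat) (P : pred (seq nat)) :
  #|[set c : {ffun 'I_n -> 'I_k} | P (word_of c)]| = count P (words k n).
Proof.
have word_inj : injective (@word_of k n).
  move=> c d cd; apply/ffunP => i; apply: val_inj.
  by have := nth_word_of _ _ c i; rewrite cd nth_word_of.
have wordsE : perm_eq (map word_of (enum {ffun 'I_n -> 'I_k})) (words k n).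
  apply: uniq_perm => [||w]; first (by rewrite map_inj_uniq // enum_uniq);
    first exact: words_uniq.
  rewrite mem_words; apply/mapP/andP => [[c _ ->]|[/eqP sw kw]].
    rewrite size_map size_enum_ord; split=> //.
    by apply/allP => _ /mapP[i _ ->]; apply: ltn_ord.
  have wk (i : 'I_n) : (nth 0%N w i < k)%N.
    by apply: (allP kw); rewrite mem_nth ?sw.
  exists [ffun i => Ordinal (wk i)]; rewrite ?mem_enum //.
  apply: (@eq_from_nth _ 0%N) => [|i]; first by rewrite size_map size_enum_ord.
  by rewrite sw => iw; rewrite (nth_word_of _ _ _ (Ordinal iw)) ffunE.
by rewrite -(permP wordsE) count_map enumT cardsE cardE /enum_mem size_filter.
Qed.

Lemma forall_ord_all (n : nat) (p : pred nat) :
  [forall i : 'I_n, p i] = all p (iota 0 n).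
Proof.
apply/forallP/allP => [pn i|pn i]; last first.
  by apply: pn; rewrite mem_iota add0n ltn_ord.
by rewrite mem_iota => ilt; apply: (pn (Ordinal ilt)).
Qed.

Definition boundary_of (zs : seq nat) : boundary_colouring :=
  [ffun j : 'I_8 => inord (nth 0%N zs j)].

Definition word_agrees (zs w : seq nat) : bool :=
  all (fun i => all (fun k =>
      lattice_adj (nth (0, 0) block_points i) (nth (0, 0) block_points k)
      ==> (nth 0%N w i != nth 0%N w k)) (iota 0 4)) (iota 0 4) &&
  all (fun i => all (fun j =>
      lattice_adj (nth (0, 0) block_points i) (nth (0, 0) boundary_points j)
      ==> (nth 0%N w i != nth 0%N zs j)) (iota 0 8)) (iota 0 4).

Lemma nth_boundary_of (zs : seq nat) (j : 'I_8) :
  all (gtn 6) zs -> boundary_of zs j = nth 0%N zs j :> nat.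
Proof.
move=> zs6; rewrite ffunE inordK //.
(* Past the end of [zs] the default 0 is read, again a legal colour. *)
have [zj|zj] := ltnP j (size zs); last by rewrite nth_default.
by apply: (allP zs6); rewrite mem_nth.
Qed.

Lemma mem_agrees_word (zs : seq nat) (c : block_colouring) :
  all (gtn 6) zs -> (c \in agrees (boundary_of zs)) = word_agrees zs (word_of c).
Proof.
move=> zs6; rewrite inE /word_agrees -!forall_ord_all; congr andb.
  apply: eq_forallb => i; rewrite -forall_ord_all; apply: eq_forallb => k.
  by rewrite !nth_word_of.
apply: eq_forallb => i; rewrite -forall_ord_all; apply: eq_forallb => j.
by rewrite nth_word_of -nth_boundary_of.
Qed.

Lemma card_agrees_words (zs : seq nat) (v : 'I_4) (S : pred nat) :
  all (gtn 6) zs ->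
  #|[set c in agrees (boundary_of zs) | S (c v)]|
    = count (fun w => word_agrees zs w && S (nth 0%N w v)) (words 6 4).
Proof.
move=> zs6; rewrite -card_ffun_words; apply: eq_card => c.
by rewrite !inE -mem_agrees_word // inE nth_word_of.
Qed.

(** The heads [a] and [b] colour [z1], and the common tail [zs] colours the other boundary vertices.
    The totals are successors, which makes both sets of agreeing colourings nonempty. *)
Lemma le_p_low_words (R : realType) (v : 'I_4) (a b : nat) (zs S : seq nat)
    (m n m' n' : nat) :
  a != b -> all (gtn 6) (a :: zs) -> all (gtn 6) (b :: zs) ->
  count (word_agrees (a :: zs)) (words 6 4) = n.+1 ->
  count (word_agrees (b :: zs)) (words 6 4) = n'.+1 ->
  count (fun w => word_agrees (a :: zs) w && (nth 0%N w v \in S)) (words 6 4)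
    = m ->
  count (fun w => word_agrees (b :: zs) w && (nth 0%N w v \in S)) (words 6 4)
    = m' ->
  m%:R / n.+1%:R - m'%:R / n'.+1%:R <= p_low R v.
Proof.
move=> ab za zb nE n'E mE m'E.
have cardE0 cs : all (gtn 6) cs ->
    #|agrees (boundary_of cs)| = count (word_agrees cs) (words 6 4).
  move=> cs6; rewrite -card_ffun_words; apply: eq_card => c.
  by rewrite [RHS]inE mem_agrees_word.
rewrite -nE -n'E -mE -m'E -!cardE0 // -!(card_agrees_words _ v (mem S)) //.
apply: (le_p_low R v _ _ (fun x : 'I_6 => mem S (val x)));
  rewrite ?cardE0 ?nE ?n'E //.
apply/forallP => j; rewrite -!val_eqE /= !nth_boundary_of //.
by case: j => [[|j] /= _]; rewrite ?ab ?eqxx.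
Qed.

Theorem lemma6 (R : realType) :
  [/\ p_low R v1 >= 379 / 1000,
      p_low R v2 >= 107 / 1000,
      p_low R v3 >= 50 / 1000
    & p_low R v4 >= 107 / 1000].
Proof.
(* These boundary pairs and colour sets were found by exhaustive search. *)
split.
(* When [z1] has colour 0, [v1] must avoid 0 and 2, so all 119 colourings put it in the set; when
   [z1] has colour 1, only 80 of 129 do. The difference is 49/129. Totals are passed as
   predecessors. *)
- apply: le_trans (@le_p_low_words R v1 0 1 [:: 0; 1; 3; 4; 0; 2; 2]%N
    [:: 1; 3; 4; 5]%N 119 118 80 128 _ _ _ _ _ _ _); try by vm_compute.
  by lra.
(* Forbidding 0 at [v1] makes 0 likelier at its neighbour [v2]: 39/112 against 27/112. *)
- apply: le_trans (@le_p_low_words R v2 0 1 [:: 2; 3; 0; 1; 0; 1; 2]%N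
    [:: 0]%N 39 111 27 111 _ _ _ _ _ _ _); try by vm_compute.
  by lra.
(* Allowing 1 at [v1] makes 1 likelier at the opposite vertex [v3]: 26/99 against 21/99. *)
- apply: le_trans (@le_p_low_words R v3 0 1 [:: 2; 3; 2; 3; 2; 3; 2]%N
    [:: 1]%N 26 98 21 98 _ _ _ _ _ _ _); try by vm_compute.
  by lra.
(* The reflection exchanging [v2] and [v4] carries the constraints used for [v2] to these, hence the
   same counts. *)
- apply: le_trans (@le_p_low_words R v4 0 1 [:: 0; 1; 0; 1; 2; 3; 2]%N
    [:: 0]%N 39 111 27 111 _ _ _ _ _ _ _); try by vm_compute.
  by lra.
Qed.
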